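(* Let $(s_k)_{k\ge1}$ be a sequence of positive numbers with $\lim_{k\to\infty}s_k=\infty$, $\lim_{k\to\infty}\frac{s_{k+1}}{\sum_{i=1}^k s_i}=0$ and $\lim_{k\to\infty}\frac{k}{\sum_{i=1}^k s_i}=0$. Let $(\tau_{in})$, $i\in\{0,1,2,3\}$, $n\in\mathbb N$, be a stochastic $(4\times\infty)$ matrix, i.e. $\tau_{in}\ge0$ and $\sum_{i=0}^3\tau_{in}=1$ for every $n$. Let $\hat x=\Delta^4_{\alpha_1\alpha_2\ldots}$ be the number whose $4$-adic digit sequence $(\alpha_m)$ is the concatenation, over $k=1,2,\ldots$, of blocks, the $k$-th block consisting of $[\tau_{0k}s_k]$ zeros, followed by $[\tau_{1k}s_k]$ ones, followed by $[\tau_{2k}s_k]$ twos, followed by $[\tau_{3k}s_k]$ threes. If for a fixed $j\in\{0,1,2,3\}$ one has $\lim_{n\to\infty}\tau_{jn}=\lambda_j$, then the frequency of the digit $j$ in this digit sequence exists and equals $\lambda_j$, i.e. $\lim_{n\to\infty}\frac1n\#\{m\le n:\alpha_m=j\}=\lambda_j$.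
   Context: $[y]$ denotes the integer part of $y$. $\Delta^4_{\alpha_1\alpha_2\ldots}$ denotes $\sum_{m\ge1}\alpha_m4^{-m}$ with digits $\alpha_m\in\{0,1,2,3\}$; the digit frequency $\nu_j(\hat x)$ is computed along this digit sequence. *)

(* Defs.v *)
From mathcomp Require Import all_boot all_order all_algebra.
From mathcomp Require Import all_classical all_reals all_analysis.

Set Implicit Arguments.
Unset Strict Implicit.
Unset Printing Implicit Defensive.

Import Order.TTheory GRing.Theory Num.Theory.
Import numFieldNormedType.Exports.

Local Open Scope ring_scope.
Local Open Scope classical_set_scope.

(* All sequences below are indexed from 1; their value at 0 is irrelevant. *)

(* Digits are the elements 0 < 1 < 2 < 3 of 'I_4, and \big[cat/[::]]_(i < 4)
   concatenates in that order. On nonnegative reals Num.truncn is the integer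
   part. *)
Definition digit_block (R : realType) (s : nat -> R) (tau : 'I_4 -> nat -> R)
    (k : nat) : seq 'I_4 :=
  \big[cat/[::]]_(i < 4) nseq (Num.truncn (tau i k * s k)) i.

(* The infinite sequence alpha_1 alpha_2 ... is b_1 ++ b_2 ++ ...: every finite
   concatenation b_1 ++ ... ++ b_K is an initial segment of it. This determines
   alpha_m for all m >= 1 as soon as the total length of the b_k is infinite. *)
Definition is_concatenation (T : Type) (b : nat -> seq T) (alpha : nat -> T) :
    Prop :=
  forall K : nat, let w := \big[cat/[::]]_(1 <= k < K.+1) b k in
    [seq alpha m | m <- iota 1 (size w)] = w.

Definition Delta4 (R : realType) (alpha : nat -> 'I_4) : R :=
  limn (fun n : nat => \sum_(1 <= m < n.+1) (alpha m)%:R / 4 ^+ m : R).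

Definition has_frequency (R : realType) (alpha : nat -> 'I_4) (j : 'I_4)
    (l : R) : Prop :=
  (fun n : nat => n%:R^-1 * (count (fun m => alpha m == j) (iota 1 n))%:R : R)
    @ \oo --> l.

(* Main.v *)
Require Import Defs.
From mathcomp Require Import all_boot all_order all_algebra.
From mathcomp Require Import all_classical all_reals all_analysis.
From mathcomp Require Import lra.

Set Implicit Arguments.
Unset Strict Implicit.
Unset Printing Implicit Defensive.

Import Order.TTheory GRing.Theory Num.Theory.
Import numFieldNormedType.Exports.

Local Open Scope ring_scope.
Local Open Scope classical_set_scope.

(** Let [S_K], [L_K], [C_K] be the sum of [s_1, ..., s_K], the number of digits
in the first [K] blocks, and the number of those digits equal to [j].  Taking
integer parts loses at most 1 per run, so [S_K - 4 K <= L_K <= S_K], and [C_K]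
is within [K] of the sum of [tau_{jk} s_k] over [k <= K], which is
[lambda S_K + o(S_K)] by Cesaro averaging.  As [K = o(S_K)], both
[L_K ~ S_K] and [C_K = lambda L_K + o(L_K)].  A prefix of length [n] between
[L_K] and [L_{K+1}] differs from the first [K] blocks by at most
[s_{K+1} = o(S_K)] digits. *)

Lemma truncn_dist_le1 (R : realType) (x : R) :
  0 <= x -> (Num.truncn x)%:R <= x <= (Num.truncn x)%:R + 1.
Proof. by move=> /truncn_itv /andP[-> /ltW]; rewrite -natr1. Qed.

Lemma size_digit_block (R : realType) (s : nat -> R) tau k :
  size (digit_block s tau k) = (\sum_(i < 4) Num.truncn (tau i k * s k))%N.
Proof.
rewrite /digit_block (big_morph size (@size_cat _) (erefl : size [::] = 0%N)).
by apply: eq_bigr => i _; rewrite size_nseq.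
Qed.

Lemma count_digit_block (R : realType) (s : nat -> R) tau k (j : 'I_4) :
  count_mem j (digit_block s tau k) = Num.truncn (tau j k * s k).
Proof.
rewrite /digit_block (big_morph (count_mem j) (count_cat _) (erefl : _ [::] = 0%N)).
rewrite (bigD1 j) //= count_nseq /= eqxx mul1n big1 ?addn0 // => i /negPf ij.
by rewrite count_nseq /= ij mul0n.
Qed.

Lemma size_digit_block_bounds (R : realType) (s : nat -> R) tau k :
  0 <= s k -> (forall i, 0 <= tau i k) -> \sum_(i < 4) tau i k = 1 ->
  s k - 4 <= (size (digit_block s tau k))%:R <= s k.
Proof.
move=> s0 t0 t1; rewrite size_digit_block natr_sum.
have trunc i := truncn_dist_le1 (mulr_ge0 (t0 i) s0).
have sE : \sum_(i < 4) tau i k * s k = s k by rewrite -mulr_suml t1 mul1r.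
apply/andP; split.
  have -> : 4 = \sum_(i < 4) 1 :> R by rewrite sumr_const card_ord.
  rewrite lerBlDr -big_split -[leLHS]sE /=.
  by apply: ler_sum => i _; case/andP: (trunc i).
by rewrite -[leRHS]sE; apply: ler_sum => i _; case/andP: (trunc i).
Qed.

(** Weighted Cesaro averaging: past some [N] each [|u i - l|] is at most [e], and the terms up to
    [N] are bounded by a constant [M]. Since [M] is a sum of nonnegative terms, it also covers the
    case [K <= N]. *)
Lemma norm_weighted_sum_le (R : realType) (u s : nat -> R) (l e : R) :
  (forall k, (1 <= k)%N -> 0 <= s k) -> 0 < e -> u @ \oo --> l ->
  exists M, forall K, `|\sum_(1 <= i < K.+1) u i * s i - l * \sum_(1 <= i < K.+1) s i|
     <= M + e * \sum_(1 <= i < K.+1) s i.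
Proof.
move=> s0 e0 /cvgrPdist_le /(_ _ e0)[N _ HN].
exists (\sum_(1 <= i < N.+1) `|u i - l| * s i) => K.
rewrite !mulr_sumr -sumrB.
under eq_bigr do rewrite -mulrBl.
have pos i : (1 <= i)%N -> 0 <= `|u i - l| * s i by move=> /s0; exact: mulr_ge0.
have [KN|NK] := leqP K N.
  rewrite (le_trans (ler_norm_sum _ _ _))// ler_wpDr//.
    by rewrite big_nat_cond sumr_ge0// => i /andP[/andP[/s0 ? _] _]; rewrite mulr_ge0// ltW.
  rewrite (big_cat_nat (n := K.+1) (p := N.+1)) //= ler_wpDr//.
    rewrite big_nat_cond sumr_ge0// => i /andP[/andP[Ki _] _].
    by rewrite pos// (leq_trans _ Ki).
  rewrite ler_sum_nat// => i /andP[i0 _].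
  by rewrite normrM (ger0_norm (s0 _ i0)).
rewrite (le_trans (ler_norm_sum _ _ _))//.
rewrite (big_cat_nat (n := N.+1)) //= ?ltnS 1?ltnW//.
rewrite [X in _ <= _ + X](big_cat_nat (n := N.+1)) //= ?ltnS 1?ltnW//.
rewrite lerD//.
  by rewrite ler_sum_nat// => i /andP[i0 _]; rewrite normrM (ger0_norm (s0 _ i0)).
rewrite ler_wpDl//.
  by rewrite big_nat_cond sumr_ge0// => i /andP[/andP[/s0 ? _] _]; rewrite mulr_ge0// ltW.
rewrite ler_sum_nat// => i /andP[Ni _].
have i0 : (1 <= i)%N by rewrite (leq_trans _ Ni).
rewrite normrM (ger0_norm (s0 _ i0)) ler_wpM2r ?s0// distrC.
exact: HN (ltnW Ni).
Qed.

Lemma near_le_mul_of_ratio_cvg0 (R : realType) (a S : nat -> R) (e : R) :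
  0 < e -> (forall k, (1 <= k)%N -> 0 < S k) ->
  (fun k => a k / S k) @ \oo --> (0 : R) ->
  \forall k \near \oo, a k <= e * S k.
Proof.
move=> e0 S0 /cvgrPdist_le /(_ _ e0) H; near=> k.
have Sk : 0 < S k by apply: S0; near: k; exists 1%N.
rewrite -ler_pdivrMr// (le_trans (ler_norm _))//.
by rewrite -normrN -sub0r; near: k.
Unshelve. all: by end_near. Qed.

(** With [K.+1] the least index such that [n < L K.+1], minimality gives [L K <= n], while [K < K0]
    would give [n < L K.+1 <= L K0 <= n]. *)
Lemma nondecreasing_bracket (L : nat -> nat) K0 n :
  {homo L : i j / (i <= j)%N} -> (exists K, n < L K)%N -> (L K0 <= n)%N ->
  exists2 K, (K0 <= K)%N & (L K <= n < L K.+1)%N.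
Proof.
move=> Lmono exK LK0; case: (ex_minnP exK) => -[|K] nK Kmin.
  by move: (leq_trans nK (leq_trans (Lmono _ _ (leq0n K0)) LK0)); rewrite ltnn.
have LKn : (L K <= n)%N by rewrite leqNgt; apply/negP => /Kmin; rewrite ltnn.
exists K; last by rewrite LKn.
rewrite leqNgt; apply/negP => KK0.
by move: (leq_trans nK (leq_trans (Lmono _ _ KK0) LK0)); rewrite ltnn.
Qed.

(** The first [size w] digits spell [w]; the other [n - size w] digits may all equal [x] or all
    differ from it. *)
Lemma count_initial_segment (T : eqType) (alpha : nat -> T) (w : seq T) (x : T) n :
  [seq alpha m | m <- iota 1 (size w)] = w -> (size w <= n)%N ->
  (count_mem x w <= count (fun m => alpha m == x) (iota 1 n)
     <= count_mem x w + (n - size w))%N.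
Proof.
move=> wE wn.
have <- : count (fun m => alpha m == x) (iota 1 (size w)) = count_mem x w.
  by rewrite -[in RHS]wE count_map.
have -> : iota 1 n = iota 1 (size w) ++ iota (1 + size w) (n - size w).
  by rewrite -iotaD subnKC.
rewrite count_cat leq_addr leq_add2l.
by rewrite (leq_trans (count_size _ _))// size_iota.
Qed.

Lemma digit_blocks_bounds (R : realType) (s : nat -> R) tau j K :
  (forall k, (1 <= k)%N -> 0 <= s k) ->
  (forall i k, (1 <= k)%N -> 0 <= tau i k) ->
  (forall k, (1 <= k)%N -> \sum_(i < 4) tau i k = 1) ->
  let w := \big[cat/[::]]_(1 <= k < K.+1) digit_block s tau k in
  let S := \sum_(1 <= k < K.+1) s k in
  let T := \sum_(1 <= k < K.+1) tau j k * s k in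
  (S - 4 * K%:R <= (size w)%:R <= S) /\
  (T - K%:R <= (count_mem j w)%:R <= T).
Proof.
move=> s0 t0 t1 /=; elim: K => [|K [/andP[? ?] /andP[? ?]]].
  by rewrite !big_geq//= !mulr0 !subr0 lexx.
rewrite !(big_nat_recr K.+1)//= size_cat count_cat count_digit_block !natrD -natr1.
have /andP[? ?] := size_digit_block_bounds (s0 K.+1 isT) (fun i => t0 i K.+1 isT) (t1 K.+1 isT).
have /andP[? ?] := truncn_dist_le1 (mulr_ge0 (t0 j K.+1 isT) (s0 K.+1 isT)).
by split; apply/andP; split; lra.
Qed.

Theorem theorem4 (R : realType) (s : nat -> R) (tau : 'I_4 -> nat -> R)
  (alpha : nat -> 'I_4) (xhat : R) (j : 'I_4) (lambda : R)
  (s_gt0 : forall k : nat, (1 <= k)%N -> 0 < s k)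
  (s_cvg : s @ \oo --> +oo)
  (s_ratio : (fun k : nat => s k.+1 / \sum_(1 <= i < k.+1) s i) @ \oo --> (0 : R))
  (k_ratio : (fun k : nat => k%:R / \sum_(1 <= i < k.+1) s i) @ \oo --> (0 : R))
  (tau_ge0 : forall (i : 'I_4) (n : nat), (1 <= n)%N -> 0 <= tau i n)
  (tau_sum1 : forall n : nat, (1 <= n)%N -> \sum_(i < 4) tau i n = 1)
  (alpha_concat : is_concatenation (digit_block s tau) alpha)
  (xhatE : xhat = Delta4 R alpha)
  (tau_cvg : tau j @ \oo --> lambda) :
  has_frequency alpha j lambda.
Proof.
have s0 k : (1 <= k)%N -> 0 <= s k by move=> /s_gt0 /ltW.
pose S K := \sum_(1 <= k < K.+1) s k.
pose w K := \big[cat/[::]]_(1 <= k < K.+1) digit_block s tau k.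
have S_gt0 K : (1 <= K)%N -> 0 < S K.
  case: K => // K _; rewrite /S big_nat_recr//= ltr_wpDl ?s_gt0//.
  by rewrite big_nat_cond sumr_ge0// => i /andP[/andP[/s0]].
have w_mono : {homo (fun K => size (w K)) : i k / (i <= k)%N >-> (i <= k)%N}.
  apply: homo_leq => [//|? ? ?|K]; first exact: leq_trans.
  by rewrite /w [X in (_ <= size X)%N]big_nat_recr//= size_cat leq_addr.
have bounds K := digit_blocks_bounds j K s0 tau_ge0 tau_sum1.
apply/cvgrPdist_le => e e0.
(* The final error is at most [(3 + 4 * |lambda|) * d * S K] with [S K <= 2 * n], and this choice of
   [d] turns it into [e * n]. *)
pose d := e / (2 * (3 + 4 * `|lambda|)).
have l0 : 0 <= `|lambda| := normr_ge0 _.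
have d0 : 0 < d by rewrite divr_gt0//; lra.
have [M HM] := norm_weighted_sum_le s0 d0 tau_cvg.
(* With this [d1], the bound [K <= d1 * S K] reads [(1 + |M|) * K <= d * S K]; adding 1 keeps the
   divisor positive. *)
pose d1 := d / (1 + `|M|).
have d10 : 0 < d1 by rewrite divr_gt0// ltr_wpDr.
have k_small c : 0 < c -> \forall K \near \oo, K%:R <= c * S K.
  by move=> c0; apply: near_le_mul_of_ratio_cvg0 c0 S_gt0 k_ratio.
(* The factor [8^-1] makes [4 * K] at most half of [S K], so that the first [K] blocks hold at least
   [S K / 2] digits. *)
have [K0 _ HK0] : \forall K \near \oo, [/\ K%:R <= d * S K, K%:R <= d1 * S K,
    K%:R <= 8^-1 * S K & s K.+1 <= d * S K].
  near=> K; split; [near: K; exact: k_small..|].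
  near: K; exact: (near_le_mul_of_ratio_cvg0 (a := fun k => s k.+1)) d0 S_gt0 s_ratio.
near=> n.
have n_gt0 : (0 < n)%N by near: n; exists 1%N.
have w_unbounded : exists K, (n < size (w K))%N.
  (* For this [K], [S K >= 8 * K], hence [size (w K) >= S K - 4 * K >= 4 * K > n]. *)
  exists (maxn K0 n.+1).
  have [_ _ h _] := HK0 (maxn K0 n.+1) (leq_maxl _ _).
  have [/andP[h1 _] _] := bounds (maxn K0 n.+1).
  rewrite -(ltr_nat R).
  have : (n.+1%:R : R) <= (maxn K0 n.+1)%:R by rewrite ler_nat leq_maxr.
  have : n%:R < n.+1%:R :> R by rewrite ltr_nat.
  have : (0 : R) <= n%:R by [].
  rewrite -/(S _) -/(w _) in h1; lra.
(* Taking the maximum with 1 ensures [1 <= K] for the index [K] bracketing [n]. *)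
have wn : (size (w (maxn K0 1)) <= n)%N.
  by near: n; exists (size (w (maxn K0 1))).
have [K] := nondecreasing_bracket w_mono w_unbounded wn.
rewrite geq_max => /andP[K0K K_gt0] /andP[wKn nwK].
have [k_d k_d1 k_8 s_d] := HK0 K K0K.
have [/andP[L1 L2] /andP[C1 C2]] := bounds K.
have /andP[] := count_initial_segment j (alpha_concat K) wKn.
rewrite -!(ler_nat R) natrD natrB//.
set c := (count _ (iota _ _))%:R => c1 c2.
have nS : n%:R <= (size (w K))%:R + s K.+1.
  have := ltnW nwK; rewrite /w (big_nat_recr K.+1)//= size_cat -(ler_nat R) natrD.
  have /andP[_] := size_digit_block_bounds (s0 K.+1 isT) (fun i => tau_ge0 i K.+1 isT)
    (tau_sum1 K.+1 isT).
  by move=> ?; lra.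
(* As [1 <= K], the bound [K = o(S_K)] absorbs the constant [M]. *)
have M_small : M <= d * S K.
  have K1 : (1 : R) <= K%:R by rewrite ler1n.
  have M0 : 0 < 1 + `|M| by rewrite ltr_wpDr.
  have := ler_wpM2l (ltW M0) k_d1.
  rewrite /d1 [_ / _]mulrC -mulrA mulVKf ?gt_eqF// => h.
  have : M <= `|M| := ler_norm M.
  have := ler_wpM2l (ltW M0) K1.
  lra.
have Lwn : (size (w K))%:R <= n%:R :> R by rewrite ler_nat.
have nR0 : (0 : R) < n%:R by rewrite ltr0n.
have := HM K; rewrite ler_norml => /andP[T1 T2].
rewrite -/(S K) -/(w K) in k_d k_8 s_d L1 L2 C1 C2 c1 c2 nS M_small T1 T2.
set T := \sum_(_ <= _ < _) _ in C1 C2 T1 T2.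
have SL : S K <= 2 * n%:R by lra.
(* Here [n - S K] lies between [- 4 * K] and [s K.+1], both at most [4 * (d * S K)] in absolute
   value. *)
have lam : `|lambda * (n%:R - S K)| <= `|lambda| * (4 * (d * S K)).
  by rewrite normrM ler_wpM2l// ler_norml; apply/andP; split; lra.
(* Write [C] for the count of [j] in [w K] and split the error as [lambda * (n - S K) + (lambda * S
   K - T) + (T - C) + (C - c)]. The second term costs [M + d * S K <= 2 * (d * S K)]. The last two
   have opposite signs and each is at most [d * S K] in absolute value, so together they cost
   [d * S K] only once, whence the 3. *)
have main : `|lambda * n%:R - c| <= (3 + 4 * `|lambda|) * (d * S K).
  move: lam; rewrite !ler_norml => /andP[lam1 lam2]; apply/andP; split; lra.
have -> : lambda - n%:R^-1 * c = (lambda * n%:R - c) / n%:R.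
  by rewrite mulrBl mulfK ?gt_eqF// [n%:R^-1 * _]mulrC.
rewrite normrM normfV (gtr0_norm nR0) ler_pdivrMr// (le_trans main)//.
have a0 : 0 < 3 + 4 * `|lambda| by lra.
have -> : e = 2 * ((3 + 4 * `|lambda|) * d).
  by rewrite mulrA /d mulrC divfK// gt_eqF// mulr_gt0.
have := ler_wpM2l (ltW (mulr_gt0 a0 d0)) SL.
lra.
Unshelve. all: by end_near. Qed.
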